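(* Let $G:\mathtt{Y}\to\mathbb{R}^{d}$ be Fréchet-differentiable at every $\mathtt{y}\in\mathtt{Y}$. Let $(u^{\ast},\psi^{\ast},\omega^{\ast})\in\mathbb{U}\times\mathbb{A}\times\mathbb{B}$, with $\omega^{\ast}>0$, be a fixed point of $\Phi$ and let $v^{\ast}:=\mathcal{G}(u^{\ast},\psi^{\ast})$. Assume that there exist $r>0$ and $\kappa\ge0$ such that $$\|DG(\mathtt{y})-DG(v^{\ast}_{t}\circ s_{\omega^{\ast}})\|_{\mathbb{R}^{d}\leftarrow\mathtt{Y}}\leq\kappa\|\mathtt{y}-v^{\ast}_{t}\circ s_{\omega^{\ast}}\|_{\mathtt{Y}}$$ for every $\mathtt{y}\in\overline B(v^{\ast}_{t}\circ s_{\omega^{\ast}},r)$, uniformly with respect to $t\in[0,1]$. Then there exist $r_{2}\in(0,\omega^{\ast})$ and $\kappa_{2}\geq0$ such that $$\|D\Phi(u,\psi,\omega)-D\Phi(u^{\ast},\psi^{\ast},\omega^{\ast})\|_{\mathbb{U}\times\mathbb{A}\times\mathbb{B}\leftarrow\mathbb{U}\times\mathbb{A}\times(0,+\infty)}\leq\kappa_{2}\|(u,\psi,\omega)-(u^{\ast},\psi^{\ast},\omega^{\ast})\|_{\mathbb{U}\times\mathbb{A}\times\mathbb{B}}$$ for all $(u,\psi,\omega)\in\overline{B}((u^{\ast},\psi^{\ast},\omega^{\ast}),r_{2})$.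
   Context: Spaces and notation. $d$ is a positive integer, $|\cdot|$ a norm on finite-dimensional spaces, $\tau>0$ the maximum delay. Derivatives with respect to time are from the right. $B^{\infty}([a,b],\mathbb{R}^{d})$ is the Banach space of measurable bounded functions with $\|f\|_{\infty}=\sup|f|$; $B^{1,\infty}([a,b],\mathbb{R}^{d})$ is the Banach space of continuous functions with measurable and bounded first derivative, with norm $\|f\|_\infty+\|f'\|_\infty$. Product spaces carry the maximum of the component norms. $\overline B(x,r)$ is the closed ball. $\|A\|_{V\leftarrow S}:=\sup_{x\in S\setminus\{0\}}\|Ax\|_V/\|x\|$. Set $\mathtt{Y}=B^{\infty}([-\tau,0],\mathbb{R}^{d})$, $Y=B^{\infty}([-1,0],\mathbb{R}^{d})$, $\mathbb{U}=B^{\infty}([0,1],\mathbb{R}^{d})$, $\mathbb{V}=B^{1,\infty}([-1,1],\mathbb{R}^{d})$, $\mathbb{A}=B^{1,\infty}([-1,0],\mathbb{R}^{d})$, $\mathbb{B}=\mathbb{R}$. For $\omega>0$, $s_{\omega}(\sigma):=\sigma/\omega$ for $\sigma\in[-\tau,0]$; the periods considered satisfy $\tau\le\omega$ (otherwise one replaces the period by a multiple), so $s_\omega$ maps into $[-1,0]$. For $v:[-1,1]\to\mathbb{R}^{d}$ and $t\in[0,1]$, $v_{t}(\theta):=v(t+\theta)$, $v_t'(\theta):=v'(t+\theta)$, $\theta\in[-1,0]$; $v_\cdot\circ s_\omega$ is the map $t\mapsto v_t\circ s_\omega$. Operators. $\mathcal{G}(u,\psi)(t)=\psi(0)+\int_{0}^{t}u(s)\,ds$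 for $t\in[0,1]$, $\mathcal{G}(u,\psi)(t)=\psi(t)$ for $t\in[-1,0]$. $p$ (the phase condition) is a linear continuous real-valued functional on functions on $[0,1]$ (continuity being understood so that $v\mapsto p(v|_{[0,1]})$ is bounded on $\mathbb{V}$). The operator $\Phi$ is $$\Phi(u,\psi,\omega)=\big(\omega G(\mathcal{G}(u,\psi)_{\cdot}\circ s_{\omega}),\ \mathcal{G}(u,\psi)_{1},\ \omega-p(\mathcal{G}(u,\psi)|_{[0,1]})\big),$$ and its Fréchet derivative (from the right with respect to $\omega$, i.e. for increments in $\mathbb{U}\times\mathbb{A}\times(0,+\infty)$) is $$D\Phi(\hat u,\hat\psi,\hat\omega)(u,\psi,\omega)=\big(\mathfrak{L}(\cdot;\hat v,\hat\omega)\mathcal{G}(u,\psi)_{\cdot}\circ s_{\hat\omega}+\omega\mathfrak{M}(\cdot;\hat v,\hat\omega),\ \mathcal{G}(u,\psi)_{1},\ \omega-p(\mathcal{G}(u,\psi)|_{[0,1]})\big)$$ with $\hat v=\mathcal{G}(\hat u,\hat\psi)$, $\mathfrak{L}(t;v,\omega)=\omega DG(v_t\circ s_\omega)$ and $\mathfrak{M}(t;v,\omega)=G(v_t\circ s_\omega)-\mathfrak{L}(t;v,\omega)[v_t'\circ s_\omega\cdot\frac{s_\omega}{\omega}]$. *)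

(* Defs.v *)
From HB Require Import structures.
From mathcomp Require Import all_boot all_order all_algebra.
From mathcomp Require Import all_classical all_reals all_analysis measurable_realfun.
Set Implicit Arguments.
Unset Strict Implicit.
Unset Printing Implicit Defensive.
Import Order.TTheory GRing.Theory Num.Theory.
Import numFieldNormedType.Exports.
Local Open Scope classical_set_scope.
Local Open Scope ring_scope.

Record vnorm (R : realType) (d : nat) := Vnorm {
  vnorm_fun :> 'rV[R]_d -> R ;
  vnormD : forall x y, vnorm_fun (x + y) <= vnorm_fun x + vnorm_fun y ;
  vnormZ : forall (l : R) x, vnorm_fun (l *: x) = `|l| * vnorm_fun x ;
  vnorm0_eq0 : forall x, vnorm_fun x = 0 -> x = 0 }.

(* R^d normed by N; a copy of 'rV[R]_d, whose library norm is the max norm *)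
Definition Rd (R : realType) (d : nat) (N : vnorm R d) : Type := 'rV[R]_d.

Section Rd_normed.
Context {R : realType} {d : nat} (N : vnorm R d).

HB.instance Definition _ := GRing.Lmodule.copy (Rd N) 'rV[R]_d.
HB.instance Definition _ := Lmodule_isNormed.Build R (Rd N)
  (@vnormD R d N) (@vnormZ R d N) (@vnorm0_eq0 R d N).

Definition coord (x : Rd N) (i : 'I_d) : R := (x : 'rV[R]_d) ord0 i.

Lemma coordD x y i : coord (x + y) i = coord x i + coord y i.
Proof. exact: mxE. Qed.

Lemma coordZ a x i : coord (a *: x) i = a * coord x i.
Proof. exact: mxE. Qed.

Lemma coord0 i : coord 0 i = 0.
Proof. exact: mxE. Qed.

Lemma coordP (x y : Rd N) : (forall i, coord x i = coord y i) -> x = y.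
Proof. by move=> xy; apply/rowP. Qed.

Lemma norm_le_coord : exists C : R, 0 < C /\
  forall (x : Rd N) (M : R), (forall i, `|coord x i| <= M) -> 0 <= M ->
  `|x| <= C * M.
Proof.
pose e (i : 'I_d) : Rd N := (delta_mx ord0 i : 'rV[R]_d).
exists (\sum_i `|e i| + 1); split.
  by rewrite ltr_wpDl// sumr_ge0.
move=> x M xM M0.
have -> : x = \sum_i (coord x i *: e i) :> Rd N.
  exact: (row_sum_delta (x : 'rV[R]_d)).
apply: (le_trans (ler_norm_sum _ _ _)).
rewrite mulrDl mul1r mulr_suml ler_wpDr// ler_sum// => i _.
by rewrite normrZ mulrC ler_wpM2l.
Qed.

Lemma coord_le_norm : exists C : R, 0 < C /\
  forall (x : Rd N) i, `|coord x i| <= C * `|x|.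
Proof.
have [C [C0 NC]] := norm_le_coord.
have NCx (x : 'rV[R]_d) : `|(x : Rd N)| <= C * `|x|.
  apply: NC => // i; rewrite (_ : `|x| = mx_norm x)// mx_normrE.
  by apply/bigmax_geP; right; exists (ord0, i).
pose f (x : 'rV[R]_d) : R := `|(x : Rd N)|.
have cf : continuous f.
  move=> x; apply/(@cvgrPdist_lt _ _ _ _ (nbhs_filter x)) => e e0.
  have nx : nbhs (x : 'rV[R]_d) [set y | `|x - y| < e / C].
    apply/(@nbhs_ballP R ('rV[R]_d : pseudoMetricType R)); exists (e / C) => /=; first by rewrite divr_gt0.
    by move=> y; rewrite mx_norm_ball.
  apply: filterS nx => y/= xy.
  apply: (@le_lt_trans _ _ (C * `|x - y|)).
    by rewrite (le_trans _ (NCx _))// /f ler_dist_dist.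
  by rewrite mulrC -ltr_pdivlMr.
pose S := [set x : 'rV[R]_d | `|x| = 1].
have cS : compact S.
  apply: bounded_closed_compact.
    by exists 1; split => // M M1 x /= ->; exact: ltW.
  rewrite (_ : S = (fun x : 'rV[R]_d => `|x|) @^-1` [set 1])//.
  apply: closed_comp; last exact: closed_eq.
  by move=> x _; exact: norm_continuous.
have coord_le (x : 'rV[R]_d) i : `|x ord0 i| <= `|x|.
  rewrite (_ : `|x| = mx_norm x)// mx_normrE.
  by apply/bigmax_geP; right; exists (ord0, i).
have unitS (x : 'rV[R]_d) : x != 0 -> S (`|x|^-1 *: x).
  move=> x0; rewrite /S/= normrZ ger0_norm ?invr_ge0// mulVf//.
  by rewrite normr_eq0.
have [S0|/set0P S0] := eqVneq S set0.
  exists 1; split => // x i; have [x0|x0] := eqVneq (x : 'rV[R]_d) 0.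
    by rewrite (_ : x = 0 :> Rd N)// coord0 !normr0 mulr0.
  by have := unitS x x0; rewrite S0.
have [c cS1 cmin] := compact_EVT_min S0 cS (@continuous_subspaceT _ _ _ _ cf).
have c0 : 0 < f c.
  rewrite normr_gt0; apply/eqP => c0; move: cS1; rewrite inE /S/= => /eqP.
  rewrite (_ : c = 0 :> 'rV[R]_d)// normr0 eq_sym oner_eq0//.
exists (f c)^-1; split; first by rewrite invr_gt0.
move=> x i; have [x0|x0] := eqVneq (x : 'rV[R]_d) 0.
  by rewrite (_ : x = 0 :> Rd N)// coord0 !normr0 mulr0.
pose m : R := `|x : 'rV[R]_d|.
have m0 : 0 < m by rewrite normr_gt0.
have /(_ (m^-1 *: (x : 'rV[R]_d))) := cmin; rewrite inE => /(_ (unitS _ x0)).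
have -> : f (m^-1 *: (x : 'rV[R]_d)) = m^-1 * `|x|.
  rewrite -[in RHS](@gtr0_norm _ m^-1) ?invr_gt0//.
  exact: (normrZ m^-1 x).
rewrite mulrC ler_pdivlMr// => H.
rewrite mulrC ler_pdivlMr// mulrC; apply: le_trans H.
by rewrite ler_wpM2l ?coord_le// ltW.
Qed.

End Rd_normed.

Section bounded_measurable.
Context {R : realType} {d : nat} {N : vnorm R d} {a b : R}.
Local Notation E := (Rd N).
Implicit Types f g : R -> E.

(* A function on [a, b] is represented by its extension by 0 to R, so that
   equality on [a, b] is equality of functions *)
Definition is_Binf f : Prop :=
  [/\ forall i, measurable_fun `[a, b] (fun t => coord (f t) i),
      exists M, forall t, t \in `[a, b] -> `|f t| <= M
    & forall t, t \notin `[a, b] -> f t = 0].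

Definition Binf_pred : {pred R -> E} := [pred f | `[< is_Binf f >]].

Lemma Binf_submod_closed : submod_closed Binf_pred.
Proof.
split.
  apply/asboolP; split=> //; by exists 0 => t _; rewrite normr0.
move=> c f g /asboolP[mf [M fM] f0] /asboolP[mg [M' gM] g0].
apply/asboolP; split.
- move=> i; rewrite (_ : (fun t => _) =
    (fun t => c * coord (f t) i + coord (g t) i)); last first.
    by apply/funext => t; rewrite -coordZ -coordD.
  by apply: measurable_funD => //; apply: measurable_funM.
- exists (`|c| * M + M') => t tab.
  rewrite (le_trans (ler_normD _ _))// normrZ lerD ?gM// ler_wpM2l//.
  exact: fM.
- by move=> t tab; rewrite !fctE f0// g0// scaler0 addr0.
Qed.

HB.instance Definition _ :=
  GRing.isSubmodClosed.Build _ _ Binf_pred Binf_submod_closed.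

End bounded_measurable.
Arguments is_Binf {R d} N a b f.
Arguments Binf_pred {R d} N a b.

Record Binf (R : realType) (d : nat) (N : vnorm R d) (a b : R) := MkBinf {
  Binf_fun :> R -> Rd N ;
  _ : Binf_fun \in Binf_pred N a b }.

Section Binf_normed.
Context {R : realType} {d : nat} (N : vnorm R d) (a b : R).
Local Notation B := (Binf N a b).
Implicit Types f g : B.

HB.instance Definition _ := [isSub for @Binf_fun R d N a b].
HB.instance Definition _ := [Choice of B by <:].
HB.instance Definition _ := [SubChoice_isSubLmodule of B by <:].

Lemma BinfP f : is_Binf N a b f.
Proof. by case: f => f /= /asboolP. Qed.

Lemma BinfD f g t : (f + g) t = f t + g t.
Proof. by []. Qed.

Lemma BinfZ c f t : (c *: f) t = c *: f t.
Proof. by []. Qed.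

Lemma Binf_eqP f g : (forall t, t \in `[a, b] -> f t = g t) -> f = g.
Proof.
move=> fg; apply/val_inj/funext => t /=.
have [tab|tab] := boolP (t \in `[a, b]); first exact: fg.
by have [_ _ ->//] := BinfP f; have [_ _ ->] := BinfP g.
Qed.

Definition supnorm (f : R -> Rd N) : R := sup [set `|f t| | t in `[a, b]].

Lemma supnorm_ub f t : t \in `[a, b] -> `|f t| <= supnorm f.
Proof.
move=> tab; apply: ub_le_sup; last by exists t.
by have [_ [M fM] _] := BinfP f; exists M => _ [x xab <-]; exact: fM.
Qed.

Lemma supnorm_le f M : 0 <= M -> (forall t, t \in `[a, b] -> `|f t| <= M) ->
  supnorm f <= M.
Proof.
move=> M0 fM; rewrite /supnorm; have [->|/set0P ne] := eqVneq [set `|f t| | t in `[a, b]] set0.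
  by rewrite sup0.
by apply: ge_sup => // _ [t tab <-]; exact: fM.
Qed.

Lemma supnorm_ge0 f : 0 <= supnorm f.
Proof.
rewrite /supnorm; have [->|/set0P[_ [t tab _]]] := eqVneq [set `|f t| | t in `[a, b]] set0.
  by rewrite sup0.
by rewrite (le_trans _ (supnorm_ub f tab)).
Qed.

Lemma supnormD f g : supnorm (f + g : B) <= supnorm f + supnorm g.
Proof.
apply: supnorm_le => [|t tab]; first by rewrite addr_ge0 ?supnorm_ge0.
by rewrite BinfD (le_trans (ler_normD _ _))// lerD ?supnorm_ub.
Qed.

Lemma supnormZ (l : R) f : supnorm (l *: f : B) = `|l| * supnorm f.
Proof.
have le k h : supnorm (k *: h : B) <= `|k| * supnorm h.
  apply: supnorm_le => [|t tab]; first by rewrite mulr_ge0 ?supnorm_ge0.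
  by rewrite BinfZ normrZ ler_wpM2l ?supnorm_ub.
apply/eqP; rewrite eq_le le/=; have [->|l0] := eqVneq l 0.
  by rewrite normr0 mul0r; exact: (supnorm_ge0 (0 *: f : B)).
have := le l^-1 (l *: f); rewrite scalerA mulVf// scale1r normfV.
by rewrite mulrC ler_pdivlMr ?normr_gt0// mulrC.
Qed.

Lemma supnorm_eq0 f : supnorm f = 0 -> f = 0.
Proof.
move=> f0; apply: Binf_eqP => t tab; apply/eqP.
by rewrite -normr_le0 -f0 supnorm_ub.
Qed.

HB.instance Definition _ := Lmodule_isNormed.Build R B
  supnormD supnormZ supnorm_eq0.

Lemma Binf_normE f : `|f| = supnorm f.
Proof. by []. Qed.

End Binf_normed.

Section integral.
Context {R : realType} {d : nat} {N : vnorm R d}.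
Local Notation E := (Rd N).
Local Notation mu := (@lebesgue_measure R).

(* \int_s^t f(x) dx for s <= t, componentwise *)
Definition vint (f : R -> E) (s t : R) : E :=
  (\row_i \int[mu]_(x in `[s, t]) coord (f x) i : 'rV[R]_d).

Lemma coord_vint f s t i :
  coord (vint f s t) i = \int[mu]_(x in `[s, t]) coord (f x) i.
Proof. exact: mxE. Qed.

Lemma Binf_bounded a b (f : Binf N a b) : exists M, 0 <= M /\ forall t, `|f t| <= M.
Proof.
have [_ [M fM] f0] := BinfP f; exists `|M|; split=> // t.
have [tab|tab] := boolP (t \in `[a, b]); last by rewrite f0// normr0.
by rewrite (le_trans (fM _ tab))// ler_norm.
Qed.

Lemma Binf_measurable a b (f : Binf N a b) i :
  measurable_fun setT (fun t => coord (f t) i).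
Proof.
have [mf _ f0] := BinfP f.
have /measurable_restrictT : measurable (`[a, b]%classic : set R) by [].
move=> /(_ _ _ (fun t => coord (f t) i))[/(_ (mf i)) + _].
apply: eq_measurable_fun => t _; rewrite patchE; case: ifPn => //.
by rewrite notin_setE/= => /negP tab; rewrite f0// coord0.
Qed.

Lemma integrable_coord (f : R -> E) M s t i :
  measurable_fun setT (fun t => coord (f t) i) ->
  (forall t, `|f t| <= M) ->
  mu.-integrable `[s, t] (EFin \o (fun x => coord (f x) i)).
Proof.
move=> mf fM; apply: measurable_bounded_integrable => //.
- by rewrite /= lebesgue_measure_itv/=; case: ifPn => // _; rewrite ltry.
- exact: measurable_funS mf.
have [C [C0 Cle]] := coord_le_norm N.
exists (C * M); split=> [|K MK]; first exact: num_real.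
move=> x _ /=.
by rewrite (le_trans _ (ltW MK))// (le_trans (Cle _ _))// ler_wpM2l// ltW.
Qed.

Lemma Binf_integrable a b (f : Binf N a b) s t i :
  mu.-integrable `[s, t] (EFin \o (fun x => coord (f x) i)).
Proof.
have [M [_ fM]] := Binf_bounded f.
exact: integrable_coord (Binf_measurable f i) fM.
Qed.

Lemma vint_linear a b (c : R) (f g : Binf N a b) s t :
  vint (c *: f + g) s t = c *: vint f s t + vint g s t.
Proof.
apply: coordP => i; rewrite coordD coordZ !coord_vint -RintegralZl//; last first.
  exact: Binf_integrable.
rewrite -RintegralD//; last exact: Binf_integrable.
  by apply: eq_Rintegral => x _; rewrite -coordZ -coordD.
by have := Binf_integrable (c *: f) s t i; apply: eq_integrable => // x _ /=;
  rewrite -coordZ.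
Qed.

Lemma eq_vint (f g : R -> E) s t : (forall x, x \in `[s, t] -> f x = g x) ->
  vint f s t = vint g s t.
Proof.
move=> fg; apply: coordP => i; rewrite !coord_vint; apply: eq_Rintegral => x.
by rewrite inE/= => xst; rewrite fg.
Qed.

Lemma vint_nil (f : R -> E) s : vint f s s = 0.
Proof.
by apply: coordP => i; rewrite coord_vint set_itv1 Rintegral_set1 coord0.
Qed.

Lemma eq_vint_o a b a' b' (f : Binf N a b) (g : Binf N a' b') s t :
  (forall x, x \in `[s, t[ -> f x = g x) -> vint f s t = vint g s t.
Proof.
move=> fg; apply: coordP => i; rewrite !coord_vint.
have ico c e (h : Binf N c e) :
  mu.-integrable `[s, t[ (EFin \o (fun x => coord (h x) i)).
  by apply: integrableS (Binf_integrable h s t i) => //; exact: subset_itv_co_cc.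
rewrite -!Rintegral_itv_bndo_bndc//; apply: eq_Rintegral => x.
by rewrite inE/= => xst; rewrite fg.
Qed.

Lemma vint_cat a b (f : Binf N a b) s u t : s <= u -> u <= t ->
  vint f s t = vint f s u + vint f u t.
Proof.
move=> su ut; apply: coordP => i; rewrite coordD !coord_vint.
apply/eqP; rewrite addrC -subr_eq; apply/eqP.
rewrite Rintegral_itvB ?bnd_simp//; last exact: Binf_integrable.
rewrite Rintegral_itv_obnd_cbnd//.
apply: integrableS (Binf_integrable f u t i) => //; exact: subset_itv_oc_cc.
Qed.

Lemma vint_shift a b (f : Binf N a b) c s t :
  vint (fun x => f (c + x)) s t = vint f (c + s) (c + t).
Proof.
apply: coordP => i; rewrite !coord_vint /Rintegral; congr fine.
pose T : measurableTypeR R -> measurableTypeR R := fun x => c + x.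
have mT : measurable_fun setT T.
  by apply: continuous_measurable_fun => x; apply: cvgD; [exact: cvg_cst|].
have muT A : measurable A -> pushforward mu T A = mu A.
  move=> mA; apply/esym/lebesgue_measure_unique => //= _ [[x y]] _ <-.
  rewrite /pushforward.
  rewrite (_ : T @^-1` _ = `](x - c), (y - c)]%classic); last first.
    by apply/seteqP; split=> z /=; rewrite !in_itv/= /T ltrBlDl lerBrDl.
  by rewrite /= !lebesgue_measure_itv/= !lte_fin ltrD2r -!EFinD opprB addrA subrK.
have -> : (`[s, t] = T @^-1` `[c + s, c + t])%classic.
  by apply/seteqP; split=> z /=; rewrite !in_itv/= /T !lerD2l.
rewrite -(integral_pushforward mT (f := EFin \o (fun x => coord (f x) i)))//.
- by apply: eq_measure_integral => A mA _; exact: muT.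
- by apply/measurable_EFinP; exact: Binf_measurable.
- rewrite (_ : T @^-1` _ = `[s, t]%classic); last first.
    by apply/seteqP; split=> z /=; rewrite !in_itv/= /T !lerD2l.
  have [M [_ fM]] := Binf_bounded f.
  apply: (@integrable_coord (fun x => f (c + x)) M) => //.
  by apply: (measurableT_comp (Binf_measurable f i)).
Qed.

End integral.

(* Elements of B^{1,oo}([a, b], R^d) are pairs (f, f') with f' bounded and
   measurable and f(t) = f(s) + \int_s^t f' for s <= t in [a, b] (so f is
   continuous). The derivative is part of the data because a primitive of a
   bounded measurable function need not be differentiable from the right
   everywhere; f' is the right derivative of f almost everywhere, and wherever
   f' is continuous from the right. *)
Definition B1inf_pred (R : realType) (d : nat) (N : vnorm R d) (a b : R) :
    {pred Binf N a b * Binf N a b} :=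
  [pred w : Binf N a b * Binf N a b | `[< forall s t, a <= s -> s <= t -> t <= b ->
                  w.1 t = w.1 s + vint w.2 s t >]].
Arguments B1inf_pred {R d} N a b.

Section B1inf_submod.
Context {R : realType} {d : nat} (N : vnorm R d) (a b : R).

Lemma B1inf_submod_closed : submod_closed (B1inf_pred N a b).
Proof.
have lin (c : R) (f g : Binf N a b * Binf N a b) :
    f \in B1inf_pred N a b -> g \in B1inf_pred N a b ->
    c *: f + g \in B1inf_pred N a b.
  move=> /asboolP fP /asboolP gP; apply/asboolP => s t sa st tb.
  rewrite -[(c *: f + g).1]/(c *: f.1 + g.1) -[(c *: f + g).2]/(c *: f.2 + g.2).
  rewrite vint_linear !BinfD !BinfZ (fP _ _ sa st tb) (gP _ _ sa st tb).
  by rewrite scalerDr addrACA.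
split; last by move=> c f g; exact: lin.
apply/asboolP => s t _ _ _.
have -> : vint (0 : Binf N a b) s t = 0.
  apply: coordP => i; rewrite coord_vint coord0.
  rewrite (@eq_Rintegral _ _ _ _ _ (cst 0)) ?Rintegral_cst ?mul0r//.
by rewrite addr0.
Qed.

HB.instance Definition _ :=
  GRing.isSubmodClosed.Build _ _ (B1inf_pred N a b) B1inf_submod_closed.

End B1inf_submod.

Record B1inf (R : realType) (d : nat) (N : vnorm R d) (a b : R) := MkB1inf {
  B1inf_pair : Binf N a b * Binf N a b ;
  _ : B1inf_pair \in B1inf_pred N a b }.

Section B1inf_normed.
Context {R : realType} {d : nat} {N : vnorm R d} {a b : R}.
Local Notation B1 := (B1inf N a b).
Implicit Types v w : B1.

HB.instance Definition _ := [isSub for @B1inf_pair R d N a b].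
HB.instance Definition _ := [Choice of B1 by <:].
HB.instance Definition _ := [SubChoice_isSubLmodule of B1 by <:].

Definition fct v : Binf N a b := (B1inf_pair v).1.
Definition der v : Binf N a b := (B1inf_pair v).2.

Lemma B1infP v s t : a <= s -> s <= t -> t <= b ->
  fct v t = fct v s + vint (der v) s t.
Proof. by case: v => v vP; have /asboolP := vP; apply. Qed.

Lemma B1inf_eqP v w : fct v = fct w -> der v = der w -> v = w.
Proof.
rewrite /fct /der => vw vw'; apply/val_inj => /=.
by rewrite [LHS]surjective_pairing vw vw' -surjective_pairing.
Qed.

Definition B1norm v : R := `|fct v| + `|der v|.

Lemma B1normD v w : B1norm (v + w) <= B1norm v + B1norm w.
Proof. by rewrite /B1norm addrACA lerD// ler_normD. Qed.

Lemma B1normZ (l : R) v : B1norm (l *: v) = `|l| * B1norm v.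
Proof. by rewrite /B1norm mulrDr -!normrZ. Qed.

Lemma B1norm_eq0 v : B1norm v = 0 -> v = 0.
Proof.
move=> /eqP; rewrite paddr_eq0// !normr_eq0 => /andP[/eqP v0 /eqP v'0].
exact: B1inf_eqP.
Qed.

HB.instance Definition _ := Lmodule_isNormed.Build R B1
  B1normD B1normZ B1norm_eq0.

Lemma B1inf_normE v : `|v| = `|fct v| + `|der v|.
Proof. by []. Qed.

End B1inf_normed.

Section constructions.
Context {R : realType} {d : nat} {N : vnorm R d}.
Local Notation E := (Rd N).

Lemma is_Binf_patch (a b : R) (f : R -> E) M :
  (forall i, measurable_fun `[a, b] (fun t => coord (f t) i)) ->
  (forall t, t \in `[a, b] -> `|f t| <= M) ->
  (fun t => if t \in `[a, b] then f t else 0) \in Binf_pred N a b.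
Proof.
move=> mf fM; apply/asboolP; split.
- move=> i; apply: eq_measurable_fun (mf i) => t; rewrite inE/= => tab.
  by rewrite tab.
- by exists M => t tab; rewrite tab fM.
- by move=> t /negbTE ->.
Qed.

Lemma measurable_affine (k c : R) : measurable_fun setT (fun x : R => c + x * k).
Proof. by apply: measurable_funD => //; apply: measurable_funM. Qed.

Lemma Binf_comp_measurable a b (f : Binf N a b) (k c : R) (D : set R) i : measurable D ->
  measurable_fun D (fun x : R => coord (f (c + x * k)) i).
Proof.
move=> mD; apply: measurable_funTS.
exact: (measurableT_comp (Binf_measurable f i) (measurable_affine k c)).
Qed.

Definition translate_fun (f : R -> E) (c a b t : R) : E :=
  if t \in `[a, b] then f (c + t) else 0.

Lemma translate_subproof a b (f : Binf N a b) c a' b' :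
  translate_fun f c a' b' \in Binf_pred N a' b'.
Proof.
have [M [_ fM]] := Binf_bounded f.
apply: (@is_Binf_patch _ _ (fun t => f (c + t)) M) => // i.
have := @Binf_comp_measurable _ _ f 1 c `[a', b']%classic i (measurable_itv _).
by apply: eq_measurable_fun => x _; rewrite mulr1.
Qed.

(* t |-> f (c + t) on [a', b'] *)
Definition translate a b (f : Binf N a b) c a' b' : Binf N a' b' :=
  MkBinf (translate_subproof f c a' b').

Lemma translate1_subproof a b (v : B1inf N a b) c a' b' :
  a <= c + a' -> c + b' <= b ->
  (translate (fct v) c a' b', translate (der v) c a' b') \in B1inf_pred N a' b'.
Proof.
move=> ac cb; apply/asboolP => s t sa st tb /=.
rewrite /translate_fun !in_itv/= sa tb (le_trans sa st) (le_trans st tb)/=.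
have acs : a <= c + s by rewrite (le_trans ac)// lerD2l.
have ctb : c + t <= b by rewrite (le_trans _ cb)// lerD2l.
have cst : c + s <= c + t by rewrite lerD2l.
rewrite (B1infP v acs cst ctb).
rewrite -vint_shift; congr (_ + _); apply: eq_vint => x; rewrite in_itv/=.
by move=> /andP[sx xt]; rewrite in_itv/= (le_trans sa sx) (le_trans xt tb).
Qed.

Definition translate1 a b (v : B1inf N a b) c a' b' (ac : a <= c + a')
  (cb : c + b' <= b) : B1inf N a' b' := MkB1inf (translate1_subproof v ac cb).

Definition s_ (om sg : R) : R := sg / om.

Definition window_fun (f : R -> E) (tau t om sg : R) : E :=
  if sg \in `[- tau, 0] then f (t + s_ om sg) else 0.

Lemma window_subproof a b (f : Binf N a b) tau t om :
  window_fun f tau t om \in Binf_pred N (- tau) 0.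
Proof.
have [M [_ fM]] := Binf_bounded f.
apply: (@is_Binf_patch _ _ (fun s => f (t + s_ om s)) M) => // i.
exact: Binf_comp_measurable.
Qed.

(* f_t \o s_om, an element of B^oo([- tau, 0], R^d). For f given on [-1, 1] and
   t in [0, 1] it involves only values of f in [-1, 1] when tau <= om. *)
Definition window a b (f : Binf N a b) tau t om : Binf N (- tau) 0 :=
  MkBinf (window_subproof f tau t om).

Definition wwindow_fun (f : R -> E) (tau t om sg : R) : E :=
  if sg \in `[- tau, 0] then (s_ om sg / om) *: f (t + s_ om sg) else 0.

Lemma wwindow_subproof a b (f : Binf N a b) tau t om :
  wwindow_fun f tau t om \in Binf_pred N (- tau) 0.
Proof.
have [M [M0 fM]] := Binf_bounded f.
apply: (@is_Binf_patch _ _ (fun s => (s_ om s / om) *: f (t + s_ om s))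
  (`|tau| * `|om^-1| * `|om^-1| * M)) => [i|s].
  rewrite (_ : (fun _ => _) =
    (fun s => s / om / om * coord (f (t + s / om)) i)); last first.
    by apply/funext => s; rewrite coordZ.
  apply: measurable_funM; last exact: Binf_comp_measurable.
  by apply: measurable_funM => //; apply: measurable_funM.
rewrite in_itv/= => /andP[ts s0].
rewrite normrZ ler_pM// /s_ !normrM ler_wpM2r// ler_wpM2r//.
by rewrite (ler0_norm s0) lerNl (le_trans _ ts)// lerN2 ler_norm.
Qed.

(* f_t \o s_om * (s_om / om), an element of B^oo([- tau, 0], R^d) *)
Definition wwindow a b (f : Binf N a b) tau t om : Binf N (- tau) 0 :=
  MkBinf (wwindow_subproof f tau t om).

Definition glue_fct (u : Binf N 0 1) (psi : B1inf N (-1) 0) (t : R) : E :=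
  if t \in `[-1, 0] then fct psi t
  else if t \in `[0, 1] then fct psi 0 + vint u 0 t else 0.

Definition glue_der (u : Binf N 0 1) (psi : B1inf N (-1) 0) (t : R) : E :=
  if t \in `[0, 1] then u t else if t \in `[-1, 0] then der psi t else 0.

Lemma itvN11 : (`[-1, 1] = `[-1, 0] `|` `]0, 1] :> set R)%classic.
Proof.
apply/seteqP; split=> t /=; rewrite !in_itv/=.
  move=> /andP[t1 ->]; rewrite t1 andbT/=; case: (leP t 0); by [left|right].
move=> [/andP[-> t0]|/andP[t0 ->]]/=; first by rewrite (le_trans t0).
by rewrite andbT (le_trans _ (ltW t0))// lerN10.
Qed.

Lemma glue_fct_subproof u psi : glue_fct u psi \in Binf_pred N (-1) 1.
Proof.
have [Mu [Mu0 uM]] := Binf_bounded u.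
have [Mp [Mp0 pM]] := Binf_bounded (fct psi).
have [C [C0 Cle]] := coord_le_norm N.
have [K [K0 Kle]] := norm_le_coord N.
apply/asboolP; split.
- move=> i; rewrite itvN11 measurable_funU//; split.
    apply: eq_measurable_fun (measurable_funTS (Binf_measurable (fct psi) i)).
    by move=> t; rewrite inE/= /glue_fct => ->.
  apply: (@eq_measurable_fun _ _ _ _ _ (fun t => coord (fct psi 0) i +
    parameterized_integral lebesgue_measure 0 t (fun x => coord (u x) i))).
    move=> t; rewrite inE/= in_itv/= => /andP[t0 t1].
    rewrite /glue_fct !in_itv/= (leNgt t 0) t0 andbF (ltW t0) t1/=.
    by rewrite coordD coord_vint.
  apply: measurable_funD => //.
  have pm : measurable_fun (`[0, 1]%classic : set R)
      (fun t => parameterized_integral lebesgue_measure 0 t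
        (fun x => coord (u x) i)).
    apply: subspace_continuous_measurable_fun => //.
    by apply: parameterized_integral_continuous => //; exact: Binf_integrable.
  by apply: measurable_funS pm => //; exact: subset_itv_oc_cc.
- exists (Mp + K * (C * Mu)) => t; rewrite in_itv/= => /andP[tN1 t1].
  have KCM : 0 <= K * (C * Mu) by rewrite !mulr_ge0// ltW.
  rewrite /glue_fct !in_itv/= tN1 t1/=; have [t0|t0] := leP t 0.
    by rewrite (le_trans (pM _))// lerDl.
  rewrite (ltW t0)/= (le_trans (ler_normD _ _))// lerD//.
  have CM : 0 <= C * Mu by rewrite mulr_ge0// ltW.
  apply: Kle => // i; rewrite coord_vint.
  have iu := Binf_integrable u 0 t i.
  apply: (le_trans (le_normr_Rintegral _ iu)) => //.
  apply: (@le_trans _ _ (\int[lebesgue_measure]_(x in `[0, t]) (C * Mu))).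
    apply: le_Rintegral => //.
    + exact: integrable_norm iu.
    + apply: measurable_bounded_integrable => //=.
        by rewrite lebesgue_measure_itv/=; case: ifPn => // _; rewrite ltry.
      by exists (C * Mu); split=> [|z /ltW + x _ /=]; [exact: num_real|];
        rewrite ger0_norm.
    + by move=> x _; rewrite (le_trans (Cle _ _))// ler_wpM2l// ltW.
  rewrite Rintegral_cst//= lebesgue_measure_itv/= lte_fin t0/= subr0.
  by rewrite ler_piMr.
- move=> t; rewrite /glue_fct !in_itv/= => tn.
  case: ifPn => [/andP[t1 t0]|_]; first by rewrite t1 (le_trans t0) in tn.
  case: ifPn => // /andP[t0 t1]; rewrite t1 (le_trans _ t0)// in tn.
Qed.

Lemma glue_der_subproof u psi : glue_der u psi \in Binf_pred N (-1) 1.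
Proof.
have [Mu [Mu0 uM]] := Binf_bounded u.
have [Mp [Mp0 pM]] := Binf_bounded (der psi).
have [[_ _ u0] [_ _ p0]] := (BinfP u, BinfP (der psi)).
apply/asboolP; split.
- move=> i; apply: measurable_funTS.
  rewrite (_ : (fun _ => _) = (fun t => if t \in `[0, 1] then coord (u t) i
      else coord (der psi t) i)).
    apply: measurable_fun_ifT; try exact: Binf_measurable.
    apply: (measurable_fun_bool true) => /=.
    by rewrite setTI (_ : _ @^-1` _ = `[0, 1]%classic).
  apply/funext => t; rewrite /glue_der; case: ifPn => // _.
  by case: ifPn => // t0; rewrite p0.
- exists (Mu + Mp) => t _; rewrite /glue_der; case: ifPn => _.
    by rewrite (le_trans (uM _))// lerDl.
  by case: ifPn => _; rewrite ?normr0 ?addr_ge0// (le_trans (pM _))// lerDr.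
- move=> t; rewrite /glue_der !in_itv/= => tn.
  case: ifPn => [/andP[t0 t1]|_]; first by rewrite t1 (le_trans _ t0) in tn.
  case: ifPn => // /andP[t1 t0]; rewrite t1 (le_trans t0)// in tn.
Qed.

Lemma glue_subproof u psi :
  (MkBinf (glue_fct_subproof u psi), MkBinf (glue_der_subproof u psi))
    \in B1inf_pred N (-1) 1.
Proof.
apply/asboolP => s t sa st tb /=.
pose g := MkBinf (glue_der_subproof u psi).
have gneg x y : -1 <= x -> y <= 0 -> vint g x y = vint (der psi) x y.
  move=> x1 y0; apply: eq_vint_o => z; rewrite in_itv/= => /andP[xz zy].
  have z0 := lt_le_trans zy y0.
  by rewrite /glue_der !in_itv/= leNgt z0/= (ltW z0) (le_trans x1 xz).
have gpos x y : 0 <= x -> y <= 1 -> vint g x y = vint u x y.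
  move=> x0 y1; apply: eq_vint => z; rewrite in_itv/= => /andP[xz zy].
  by rewrite /= /glue_der in_itv/= (le_trans x0 xz) (le_trans zy y1).
have fneg x : -1 <= x -> x <= 0 -> glue_fct u psi x = fct psi x.
  by move=> x1 x0; rewrite /glue_fct in_itv/= x1 x0.
have fpos x : 0 <= x -> x <= 1 -> glue_fct u psi x = fct psi 0 + vint u 0 x.
  move=> x0 x1; rewrite /glue_fct !in_itv/= x0 x1/=.
  case: ifPn => // /andP[_ xle0].
  have -> : x = 0 by apply/eqP; rewrite eq_le xle0.
  by rewrite vint_nil addr0.
have [t0|/ltW t0] := leP t 0.
  have t1 := le_trans sa st; have s0 := le_trans st t0.
  rewrite (fneg s)// (fneg t)// gneg//.
  exact: (B1infP psi sa st t0).
have [s0|/ltW s0] := leP s 0.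
  rewrite (fneg s)// (fpos t)// (vint_cat g s0 t0) (gneg s 0)// (gpos 0 t)// addrA.
  by rewrite -(B1infP psi sa s0 (lexx 0)).
have s1 := le_trans st tb; have t0' := le_trans s0 st.
by rewrite (fpos s)// (fpos t)// gpos// -addrA -vint_cat.
Qed.

(* psi continued by psi(0) + \int_0^t u; its derivative is u on [0, 1], in
   particular u(0) (the derivative from the right) at 0 *)
Definition calG (u : Binf N 0 1) (psi : B1inf N (-1) 0) : B1inf N (-1) 1 :=
  MkB1inf (glue_subproof u psi).

Lemma v1_subproof1 : -1 <= 1 + -1 :> R.
Proof. by rewrite subrr lerN10. Qed.

Lemma v1_subproof2 : 1 + 0 <= 1 :> R.
Proof. by rewrite addr0. Qed.

(* v_1 : theta |-> v (1 + theta) *)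
Definition v1 (v : B1inf N (-1) 1) : B1inf N (-1) 0 :=
  translate1 v v1_subproof1 v1_subproof2.

Lemma res01_subproof1 : -1 <= 0 + 0 :> R.
Proof. by rewrite addr0 lerN10. Qed.

Lemma res01_subproof2 : 0 + 1 <= 1 :> R.
Proof. by rewrite add0r. Qed.

(* restriction of v to [0, 1] *)
Definition res01 (v : B1inf N (-1) 1) : B1inf N 0 1 :=
  translate1 v res01_subproof1 res01_subproof2.

End constructions.

(* \sup_{x \in S \ {0}} nZ(A x) / |x|; the norm nZ of the codomain may be
   infinite *)
Definition opnorm (R : realType) (X : normedModType R) (Z : Type)
    (nZ : Z -> \bar R) (S : set X) (A : X -> Z) : \bar R :=
  ereal_sup [set (nZ (A x) * (`|x|^-1)%:E)%E | x in S `\ 0].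

Notation UAB R N := (Binf N 0 1 * B1inf N (-1) 0 * R^o)%type.

Section operators.
Context {R : realType} {d : nat} {N : vnorm R d} {tau : R}.
Variables (G : Binf N (- tau) 0 -> Rd N) (p : B1inf N 0 1 -> R).
Local Notation V := (B1inf N (-1) 1).

Definition frakL (t : R) (v : V) (om : R) (y : Binf N (- tau) 0) : Rd N :=
  om *: 'd G (window (fct v) tau t om) y.

Definition frakM (t : R) (v : V) (om : R) : Rd N :=
  G (window (fct v) tau t om) - frakL t v om (wwindow (der v) tau t om).

Definition Phi (x : UAB R N) : (R -> Rd N) * B1inf N (-1) 0 * R^o :=
  let: (u, psi, om) := x in
  let v := calG u psi in
  (fun t => if t \in `[0, 1] then om *: G (window (fct v) tau t om) else 0,
   v1 v, om - p (res01 v)).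

(* The derivative of Phi at xh, from the right in om. The first component of the
   result is a plain function on [0, 1] (extended by 0): for an arbitrary G its
   measurability in t is not clear when the derivative of calG uh psih is merely
   measurable. *)
Definition DPhi (xh x : UAB R N) : (R -> Rd N) * B1inf N (-1) 0 * R^o :=
  let: (uh, psih, omh) := xh in
  let: (u, psi, om) := x in
  let vh := calG uh psih in
  let v := calG u psi in
  (fun t => if t \in `[0, 1]
            then frakL t vh omh (window (fct v) tau t omh) + om *: frakM t vh omh
            else 0,
   v1 v, om - p (res01 v)).

End operators.

(* the (maximum) norm of U x A x B, infinite if the first component is unbounded *)
Definition UABnorm (R : realType) (d : nat) (N : vnorm R d)
    (z : (R -> Rd N) * B1inf N (-1) 0 * R^o) : \bar R :=
  maxe (maxe (ereal_sup [set `|z.1.1 t|%:E | t in `[0, 1]]) `|z.1.2|%:E)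
    `|z.2|%:E.

(* Main.v *)
(* The second and third components of D Phi(x) do not depend on x, so only the
   first one matters. It is a combination of terms om DG(y) z with
   y = v_t o s_om, and the critical one is z = v'_t o s_om * (s_om / om): its
   variation with om at the fixed point is controlled only if vs' is Lipschitz,
   whereas elements of A have a merely measurable derivative. But at a fixed
   point us(t) = oms G(vs_t o s_oms) is Lipschitz in t, and vs' is its periodic
   continuation. The constants are uniform in t because DG is bounded near the
   curve t |-> vs_t o s_oms, by chaining the Lipschitz condition along [0, 1]. *)
Require Import Defs.
From HB Require Import structures.
From mathcomp Require Import all_boot all_order all_algebra.
From mathcomp Require Import all_classical all_reals all_analysis.
From mathcomp Require Import lra ring.
Set Implicit Arguments.
Unset Strict Implicit.
Unset Printing Implicit Defensive.
Import Order.TTheory GRing.Theory Num.Theory.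
Import numFieldNormedType.Exports.
Local Open Scope classical_set_scope.
Local Open Scope ring_scope.

(** * Bounds for integrals, primitives and [calG] *)

Lemma Binf_norm_ub (R : realType) (d : nat) (N : vnorm R d) (a b : R)
    (f : Binf N a b) t : `|f t| <= `|f|.
Proof.
have [tab|tab] := boolP (t \in `[a, b]); first exact: supnorm_ub.
by have [_ _ ->//] := BinfP f; rewrite normr0.
Qed.

(** Integration is componentwise, so the estimate passes to coordinates and back; the two
    norm-equivalence constants make up [K], which depends on [N] only. *)
Lemma vint_norm_le (R : realType) (d : nat) (N : vnorm R d) :
  exists2 K : R, 0 < K & forall a b (f : Binf N a b) s t, s <= t ->
    `|vint f s t| <= K * `|f| * (t - s).
Proof.
have [C [C0 Cle]] := coord_le_norm N.
have [K [K0 Kle]] := norm_le_coord N.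
exists (K * C); first exact: mulr_gt0.
move=> a b f s t st; rewrite -!mulrA; have ts0 : 0 <= t - s by rewrite subr_ge0.
have M0 : 0 <= C * (`|f| * (t - s)) by rewrite !mulr_ge0// ltW.
apply: Kle => // i; rewrite coord_vint.
have ifi := Binf_integrable f s t i.
apply: (le_trans (le_normr_Rintegral _ ifi)) => //.
apply: (@le_trans _ _ (\int[lebesgue_measure]_(x in `[s, t]) (C * `|f|))).
  apply: le_Rintegral => //.
  - exact: integrable_norm ifi.
  - apply: measurable_bounded_integrable => //=.
      by rewrite lebesgue_measure_itv/=; case: ifPn => // _; rewrite ltry.
    exists (C * `|f|); split=> [|z /ltW + x _ /=]; first exact: num_real.
    by rewrite ger0_norm// mulr_ge0// ltW.
  - by move=> x _; rewrite (le_trans (Cle _ _))// ler_wpM2l ?Binf_norm_ub// ltW.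
rewrite Rintegral_cst//= lebesgue_measure_itv/= lte_fin.
case: ifPn => [_|]; first by rewrite -EFinB/= mulrA.
by rewrite mulr0.
Qed.

Lemma fct_lipschitz (R : realType) (d : nat) (N : vnorm R d) :
  exists2 K : R, 0 < K & forall a b (v : B1inf N a b) s t,
    s \in `[a, b] -> t \in `[a, b] ->
    `|fct v t - fct v s| <= K * `|der v| * `|t - s|.
Proof.
have [K K0 Kle] := vint_norm_le N; exists K => // a b v.
have H s t : a <= s -> s <= t -> t <= b ->
    `|fct v t - fct v s| <= K * `|der v| * `|t - s|.
  move=> sa st tb; rewrite (B1infP v sa st tb) addrAC subrr add0r.
  by rewrite [`|t - s|]ger0_norm ?subr_ge0// Kle.
move=> s t; rewrite !in_itv/= => /andP[sa sb] /andP[ta tb].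
have [st|/ltW ts] := leP s t; first exact: H.
by rewrite distrC [`|t - s|]distrC H.
Qed.

(** This turns the norm bound on [calG] below into a Lipschitz bound. *)
Lemma calGB (R : realType) (d : nat) (N : vnorm R d) (u u' : Binf N 0 1)
    (psi psi' : B1inf N (-1) 0) :
  calG u psi - calG u' psi' = calG (u - u') (psi - psi').
Proof.
have vB t : vint (u - u') 0 t = vint u 0 t - vint u' 0 t :> Rd N.
  by rewrite (_ : u - u' = -1 *: u' + u) ?vint_linear ?scaleN1r addrC.
apply: B1inf_eqP; apply: Binf_eqP => t tab.
- rewrite /= -[LHS]/(glue_fct u psi t - glue_fct u' psi' t) /glue_fct.
  case: ifPn => // _; case: ifPn => // _; last by rewrite subr0.
  by rewrite vB opprD addrACA.
- rewrite /= -[LHS]/(glue_der u psi t - glue_der u' psi' t) /glue_der.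
  by case: ifPn => // _; case: ifPn => // _; rewrite subr0.
Qed.

Lemma calG_norm_le (R : realType) (d : nat) (N : vnorm R d) :
  exists2 A : R, 0 < A & forall (u : Binf N 0 1) (psi : B1inf N (-1) 0) m,
    `|u| <= m -> `|psi| <= m -> `|calG u psi| <= A * m.
Proof.
have [K K0 Kle] := vint_norm_le N.
(* The function is bounded by [m + K * m], its derivative by [m]. *)
exists (2 + K); first by rewrite addr_gt0.
move=> u psi m um pm; have m0 : 0 <= m := le_trans (normr_ge0 _) um.
have Km0 : 0 <= K * m by rewrite mulr_ge0// ltW.
have pfm : `|fct psi| <= m by rewrite (le_trans _ pm)// B1inf_normE lerDl.
have pdm : `|der psi| <= m by rewrite (le_trans _ pm)// B1inf_normE lerDr.
rewrite B1inf_normE (_ : (2 + K) * m = (m + K * m) + m); last by ring.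
apply: lerD; apply: supnorm_le => [|t _]; rewrite ?addr_ge0//=.
- rewrite /glue_fct; case: ifPn => _.
    by rewrite (le_trans (Binf_norm_ub _ _))// (le_trans pfm)// lerDl.
  case: ifPn => [|_]; last by rewrite normr0 addr_ge0.
  rewrite in_itv/= => /andP[t0 t1]; rewrite (le_trans (ler_normD _ _))// lerD//.
    by rewrite (le_trans (Binf_norm_ub _ _)).
  rewrite (le_trans (Kle _ _ _ _ _ t0))// subr0 -mulrA ler_wpM2l//; first exact: ltW.
  by rewrite (@le_trans _ _ `|u|)// ler_piMr.
- rewrite /glue_der; case: ifPn => _; first by rewrite (le_trans (Binf_norm_ub _ _)).
  case: ifPn => _; last by rewrite normr0.
  by rewrite (le_trans (Binf_norm_ub _ _)).
Qed.

(** * Dependence of the windows on function, time and period *)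

Lemma windowB (R : realType) (d : nat) (N : vnorm R d) (a b : R)
    (f g : Binf N a b) tau t om :
  window (f - g) tau t om = window f tau t om - window g tau t om.
Proof.
by apply: Binf_eqP => x xt; rewrite /= -[RHS]/(window_fun f tau t om x -
  window_fun g tau t om x) /window_fun xt.
Qed.

Lemma wwindowB (R : realType) (d : nat) (N : vnorm R d) (a b : R)
    (f g : Binf N a b) tau t om :
  wwindow (f - g) tau t om = wwindow f tau t om - wwindow g tau t om.
Proof.
apply: Binf_eqP => x xt; rewrite /= -[RHS]/(wwindow_fun f tau t om x -
  wwindow_fun g tau t om x) /wwindow_fun xt.
by rewrite -scalerBr.
Qed.

Lemma window_norm_le (R : realType) (d : nat) (N : vnorm R d) (a b : R)
    (f : Binf N a b) tau t om : `|window f tau t om| <= `|f|.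
Proof.
apply: supnorm_le => // x xt; rewrite /= /window_fun xt.
exact: Binf_norm_ub.
Qed.

Lemma s_itv (R : realType) (tau om sg : R) : 0 < tau -> tau <= om ->
  sg \in `[- tau, 0] -> - 1 <= s_ om sg <= 0.
Proof.
move=> tau0 tauom; rewrite in_itv/= => /andP[tsg sg0].
have om0 := lt_le_trans tau0 tauom.
rewrite /s_ ler_pdivlMr// ler_pdivrMr// mul0r sg0 andbT mulN1r.
by rewrite (le_trans _ tsg)// lerN2.
Qed.

(** The difference is [- s_ om sg] times [(om - om') / om'], where the first factor lies in [0, 1]
    and [om'] is at least [tau]. *)
Lemma s_lipschitz (R : realType) (tau om om' sg : R) : 0 < tau ->
  tau <= om -> tau <= om' -> sg \in `[- tau, 0] ->
  `|s_ om sg - s_ om' sg| <= `|om - om'| / tau.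
Proof.
move=> tau0 tauom tauom' sgt.
have om0 := lt_le_trans tau0 tauom; have om'0 := lt_le_trans tau0 tauom'.
have /andP[s1 s0] := s_itv tau0 tauom sgt.
have -> : s_ om sg - s_ om' sg = - s_ om sg * ((om - om') / om').
  by rewrite /s_; field; rewrite !gt_eqF.
rewrite normrM normf_div [`|om'|]gtr0_norm// normrN ler0_norm//.
apply: (@le_trans _ _ (1 * (`|om - om'| / om'))).
  by apply: ler_wpM2r; [rewrite divr_ge0// ltW|rewrite lerNl].
by rewrite mul1r ler_wpM2l// lef_pV2.
Qed.

Lemma window_itv (R : realType) (tau om sg t : R) : 0 < tau -> tau <= om ->
  sg \in `[- tau, 0] -> t \in `[0, 1] -> t + s_ om sg \in `[-1, 1].
Proof.
move=> tau0 tauom /(s_itv tau0 tauom)/andP[s1 s0].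
by rewrite !in_itv/= => /andP[t0 t1]; apply/andP; split; lra.
Qed.

(** Here the window is that of a primitive, so boundedness of [der v] suffices. With [om = om'] this
    bounds the speed of the curve of windows; with [t = t'] it controls a change of period. *)
Lemma window_lipschitz (R : realType) (d : nat) (N : vnorm R d) :
  exists2 K : R, 0 < K & forall (v : B1inf N (-1) 1) tau t t' om om',
    0 < tau -> tau <= om -> tau <= om' -> t \in `[0, 1] -> t' \in `[0, 1] ->
    `|window (fct v) tau t om - window (fct v) tau t' om'|
      <= K * `|der v| * (`|t - t'| + `|om - om'| / tau).
Proof.
have [K K0 Kle] := fct_lipschitz N; exists K => //.
move=> v tau t t' om om' tau0 tauom tauom' t01 t'01.
have Kd0 : 0 <= K * `|der v| by rewrite mulr_ge0// ltW.
apply: supnorm_le => [|x xt].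
  by rewrite mulr_ge0// addr_ge0// divr_ge0// ltW.
rewrite -[X in `|X| <= _]/(window_fun (fct v) tau t om x
  - window_fun (fct v) tau t' om' x) /window_fun xt.
apply: (le_trans (Kle _ _ v _ _ (window_itv tau0 tauom' xt t'01)
  (window_itv tau0 tauom xt t01))).
rewrite ler_wpM2l// opprD addrACA (le_trans (ler_normD _ _))// lerD//.
exact: s_lipschitz.
Qed.

Lemma wwindow_weight_le (R : realType) (tau om sg : R) : 0 < tau ->
  tau <= om -> sg \in `[- tau, 0] -> `|s_ om sg / om| <= tau^-1.
Proof.
move=> tau0 tauom sgt; have om0 := lt_le_trans tau0 tauom.
have /andP[s1 s0] := s_itv tau0 tauom sgt.
rewrite normf_div ler0_norm// gtr0_norm// -[leRHS]mul1r.
by apply: ler_pM; rewrite ?oppr_ge0 ?invr_ge0 1?lerNl ?lef_pV2// ltW.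
Qed.

Lemma wwindow_norm_le (R : realType) (d : nat) (N : vnorm R d) (a b : R)
    (f : Binf N a b) tau t om : 0 < tau -> tau <= om ->
  `|wwindow f tau t om| <= tau^-1 * `|f|.
Proof.
move=> tau0 tauom; apply: supnorm_le => [|x xt].
  by rewrite mulr_ge0// invr_ge0 ltW.
rewrite /= /wwindow_fun xt normrZ ler_pM ?Binf_norm_ub//.
exact: wwindow_weight_le.
Qed.

(** This is meant for [f] a derivative, whose Lipschitz continuity has to be assumed. The weight and
    the argument of [f] both vary with the period; they give the terms in [|f|] and in [L]. *)
Lemma wwindow_lipschitz (R : realType) (d : nat) (N : vnorm R d)
    (f : Binf N (-1) 1) (L : R) tau t om om' : 0 <= L ->
  {in `[-1, 1] &, forall x y, `|f x - f y| <= L * `|x - y|} ->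
  0 < tau -> tau <= om -> tau <= om' -> t \in `[0, 1] ->
  `|wwindow f tau t om - wwindow f tau t om'|
    <= (2 * `|f| + L) / tau ^+ 2 * `|om - om'|.
Proof.
move=> L0 fL tau0 tauom tauom' t01.
have om0 := lt_le_trans tau0 tauom; have om'0 := lt_le_trans tau0 tauom'.
apply: supnorm_le => [|x xt].
  by rewrite mulr_ge0// divr_ge0 ?sqr_ge0// addr_ge0// mulr_ge0.
rewrite -[X in `|X| <= _]/(wwindow_fun f tau t om x
  - wwindow_fun f tau t om' x) /wwindow_fun xt.
set w := s_ om x / om; set w' := s_ om' x / om'.
set y := f _; set y' := f _.
have -> : w *: y - w' *: y' = (w - w') *: y + w' *: (y - y').
  by rewrite scalerBl scalerBr subrKA.
have /andP[s1 s0] := s_itv tau0 tauom xt.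
(* The weight is divided by the period twice, and each division contributes one
   [|om - om'| / tau ^+ 2]. *)
have ww' : `|w - w'| <= 2 * (`|om - om'| / tau ^+ 2).
  have -> : w - w' = - (w * ((om - om') / om')) + (s_ om x - s_ om' x) / om'.
    by rewrite /w /w'; field; rewrite !gt_eqF.
  rewrite (le_trans (ler_normD _ _))// mulr_natl mulr2n lerD//.
    rewrite normrN normrM [X in _ * X]normf_div [`|om'|]gtr0_norm//.
    rewrite mulrC expr2 invfM mulrA.
    apply: ler_pM; [|by []| |exact: wwindow_weight_le].
      by rewrite divr_ge0// ltW.
    by rewrite ler_wpM2l// lef_pV2.
  rewrite normf_div [`|om'|]gtr0_norm// expr2 invfM mulrA ler_pM//.
  - by rewrite invr_ge0 ltW.
  - exact: s_lipschitz.
  - by rewrite lef_pV2.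
have yy' : `|y - y'| <= L * (`|om - om'| / tau).
  apply: (le_trans (fL _ _ _ _)); rewrite ?(@window_itv _ tau)// ler_wpM2l//.
  by rewrite opprD addrACA subrr add0r s_lipschitz.
rewrite (le_trans (ler_normD _ _))// [`|_ *: y|]normrZ [`|_ *: (y - y')|]normrZ.
rewrite (_ : (2 * `|f| + L) / tau ^+ 2 * _ = 2 * (`|om - om'| / tau ^+ 2) * `|f|
  + tau^-1 * (L * (`|om - om'| / tau))); last by field; rewrite gt_eqF.
apply: lerD; apply: ler_pM => //; first exact: Binf_norm_ub.
exact: wwindow_weight_le.
Qed.

(** * Operator norms and bounds on the differential *)

Lemma opnorm_le (R : realType) (X : normedModType R) (Z : Type)
    (nZ : Z -> \bar R) (S : set X) (A : X -> Z) (c : R) :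
  (forall x, S x -> (nZ (A x) <= (c * `|x|)%:E)%E) ->
  (opnorm nZ S A <= c%:E)%E.
Proof.
move=> Ac; apply: ge_ereal_sup => _ [x [Sx /eqP x0] <-].
by rewrite lee_pdivrMr ?normr_gt0// -EFinM Ac.
Qed.

(** The supremum in [opnorm] leaves out 0, where [A 0 = 0] gives the inequality. *)
Lemma opnorm_ub (R : realType) (X Z : normedModType R) (A : X -> Z) (c : R) :
  A 0 = 0 -> (opnorm (fun z => `|z|%:E) setT A <= c%:E)%E ->
  forall x, `|A x| <= c * `|x|.
Proof.
move=> A0 Ac x; have [->|x0] := eqVneq x 0; first by rewrite A0 !normr0 mulr0.
rewrite -lee_fin EFinM -lee_pdivrMr ?normr_gt0//.
apply: le_trans Ac; apply: ereal_sup_ubound; exists x => //; split => //.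
exact/eqP.
Qed.

Lemma diff_bounded (R : realType) (X Z : normedModType R) (G : X -> Z) x :
  differentiable G x -> exists2 B : R, 0 <= B &
    forall h, `|'d G x h| <= B * `|h|.
Proof.
move=> dG.
have /linear_boundedP/pinfty_ex_gt0[B B0 BG] : bounded_near ('d G x) (nbhs 0).
  by apply: continuous_linear_bounded; exact: (diff_continuous dG).
by exists B => //; exact: ltW.
Qed.

(* Componentwise, since the mean value theorem is about scalar functions; this
   costs a factor depending on N only. *)
Lemma mean_value_le (R : realType) (d : nat) (N : vnorm R d) :
  exists2 K : R, 0 < K & forall (X : normedModType R) (G : X -> Rd N) x y B,
    (forall z, differentiable G z) -> 0 <= B ->
    (forall s : R, 0 <= s <= 1 ->
      `|'d G (x + s *: (y - x)) (y - x)| <= B) ->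
    `|G y - G x| <= K * B.
Proof.
have [C [C0 Cle]] := coord_le_norm N.
have [K [K0 Kle]] := norm_le_coord N.
exists (K * C); first exact: mulr_gt0.
move=> X G x y B dG B0 GB; rewrite -mulrA; set h := y - x in GB *.
have CB0 : 0 <= C * B by rewrite mulr_ge0// ltW.
apply: Kle => // i.
pose g (s : R) : R := Defs.coord (G (x + s *: h)) i.
have coordN (z : Rd N) : Defs.coord (- z) i = - Defs.coord z i.
  by rewrite -scaleN1r coordZ mulN1r.
have coord_cvg (F : set_system R) (FF : Filter F) (f : R -> Rd N) l :
    f @ F --> l -> (fun s => Defs.coord (f s) i) @ F --> Defs.coord l i.
  move=> /cvgrPdist_lt fl; apply/cvgrPdist_lt => e e0.
  have := fl (e / C) (divr_gt0 e0 C0); apply: filterS => s fs.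
  rewrite -coordN -coordD (le_lt_trans (Cle _ _))//.
  by rewrite mulrC -ltr_pdivlMr.
(* The difference quotient of [g] at [s] is the coordinate of that of [G] at [a] in the direction
   [h], and coordinates preserve limits. *)
have dg (s : R) : is_derive s 1 g (Defs.coord ('d G (x + s *: h) h) i).
  set a := x + s *: h.
  have /cvg_ex[l Gl] := @diff_derivable _ _ _ _ _ h (dG a).
  have lE : l = 'd G a h.
    by rewrite -deriveE// /derive; apply/esym/cvg_lim.
  have gl : e^-1 *: ((g \o shift s) (e *: 1) - g s) @[e --> 0^'] -->
      Defs.coord ('d G a h) i.
    rewrite -lE; apply: cvg_trans (coord_cvg _ _ _ _ Gl).
    apply: near_eq_cvg; apply: nearW => e.
    rewrite Defs.coordZ Defs.coordD coordN /g /=; congr (_ * (Defs.coord (G _) i - _)).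
    by rewrite /a [e *: _]mulr1 scalerDl addrCA.
  apply: DeriveDef; first by apply/cvg_ex; exists (Defs.coord ('d G a h) i).
  exact: cvg_lim gl.
have gc : {within `[0, 1], continuous g}.
  apply: continuous_subspaceT => s; apply: differentiable_continuous.
  by apply/derivable1_diffP; apply: ex_derive.
have [s] := MVT_segment ler01 (fun s _ => dg s) gc.
rewrite in_itv/= subr0 mulr1 => s01 gE.
have -> : Defs.coord (G y - G x) i = g 1 - g 0.
  rewrite /g scale1r scale0r addr0 Defs.coordD coordN; congr (Defs.coord (G _) i - _).
  by rewrite /h addrC subrK.
by rewrite gE (le_trans (Cle _ _))// ler_wpM2l ?GB// ltW.
Qed.

(** A single differential, the one at [y_ 0], is bounded by its continuity. The Lipschitz condition
    carries this bound along the curve in finitely many time steps, each short enough to stay within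
    distance [r] and each adding [kappa * r]. *)
Lemma diff_bounded_near_curve (R : realType) (X Z : normedModType R)
    (G : X -> Z) (y_ : R -> X) (c r kappa : R) :
  0 < r -> 0 <= kappa -> 0 <= c ->
  {in `[0, 1] &, forall t t', `|y_ t - y_ t'| <= c * `|t - t'|} ->
  (forall y, differentiable G y) ->
  (forall t : R, t \in `[0, 1] -> forall y, `|y - y_ t| <= r -> forall h,
    `|'d G y h - 'd G (y_ t) h| <= kappa * `|y - y_ t| * `|h|) ->
  exists2 B : R, 0 <= B & forall t : R, t \in `[0, 1] ->
    forall y, `|y - y_ t| <= r -> forall h, `|'d G y h| <= B * `|h|.
Proof.
move=> r0 kappa0 c0 ylip dG dGlip.
have step t y M : t \in `[0, 1] -> `|y - y_ t| <= r ->
    (forall h, `|'d G (y_ t) h| <= M * `|h|) ->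
    forall h, `|'d G y h| <= (M + kappa * r) * `|h|.
  move=> t01 yt HM h; rewrite -[X in `|X|](subrK ('d G (y_ t) h)).
  rewrite (le_trans (ler_normD _ _))// addrC mulrDl lerD//.
  by rewrite (le_trans (dGlip _ t01 _ yt h))// ler_wpM2r// ler_wpM2l.
have [B0 B00 dG0] := diff_bounded (dG (y_ 0)).
(* In time [e] the curve moves by at most [c * e <= r]; the summand 1 keeps the divisor positive
   when [c = 0]. *)
pose e := r / (c + 1).
have c10 : 0 < c + 1 by rewrite ltr_wpDl.
have e0 : 0 < e by rewrite divr_gt0.
have chain (n : nat) : forall t : R, t \in `[0, 1] -> t <= n%:R * e ->
    forall h, `|'d G (y_ t) h| <= (B0 + n%:R * (kappa * r)) * `|h|.
  elim: n => [|n IH] t t01 tn h.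
    have -> : t = 0.
      move: t01; rewrite in_itv/= => /andP[t0 _].
      by apply/le_anti; rewrite t0 (le_trans tn)// mul0r.
    by rewrite mul0r addr0.
  (* The previous point of the chain, cut off at 0 so as to stay in [0, 1]. *)
  pose t' := Num.max 0 (t - e).
  have [tt' t'01 t'n] : [/\ `|t - t'| <= e, t' \in `[0, 1] & t' <= n%:R * e].
    move: t01 tn; rewrite !in_itv/= -natr1 mulrDl mul1r => /andP[t0 t1] tn.
    have ne0 : 0 <= n%:R * e by rewrite mulr_ge0// ltW.
    rewrite /t'; have [te|te] := leP 0 (t - e); split.
    - by rewrite opprB addrC subrK gtr0_norm.
    - by rewrite te/= (le_trans _ t1)// gerBl ltW.
    - by rewrite lerBlDr.
    - by rewrite subr0 ger0_norm// -subr_le0 ltW.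
    - by rewrite lexx ler01.
    - by [].
  rewrite -natr1 [_ * (kappa * r)]mulrDl mul1r addrA.
  apply: (step t') => //; last exact: IH.
  rewrite (le_trans (ylip _ _ t01 t'01))//.
  apply: (@le_trans _ _ (c * e)); first exact: ler_wpM2l.
  by rewrite /e mulrCA ler_piMr ?(ltW r0)// ler_pdivrMr// mul1r lerDl.
(* After [n] steps of length [e] all of [0, 1] is reached; the last [kappa * r] of the witness pays
   for leaving the curve. *)
pose n := Num.bound e^-1.
exists (B0 + n%:R * (kappa * r) + kappa * r).
  by rewrite !addr_ge0// ?mulr_ge0// ltW.
move=> t t01 y yt; apply: (step t) => //; apply: chain => //.
move: t01; rewrite in_itv/= => /andP[_ t1]; rewrite (le_trans t1)//.
have einv0 : 0 <= e^-1 by rewrite invr_ge0 ltW.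
by rewrite -ler_pdivrMr// mul1r ltW// archi_boundP.
Qed.

(** * Lipschitz continuity of the derivative at a fixed point *)

(* psis = v1 vs makes vs' on [-1, 0[ the translate of us, and makes the windows
   at t = 0 and t = 1 equal, so that us 0 = us 1 and vs' has no jump at 0. *)
Lemma fixed_point_der_lipschitz (R : realType) (d : nat) (N : vnorm R d)
    (tau : R) (G : Binf N (- tau) 0 -> Rd N) (p : B1inf N 0 1 -> R)
    (us : Binf N 0 1) (psis : B1inf N (-1) 0) (oms r C c : R) :
  let vs := calG us psis in
  let ys t := window (fct vs) tau t oms in
  0 < tau -> tau <= oms -> 0 < r -> 0 <= C -> 0 <= c ->
  Phi G p (us, psis, oms) = (us : R -> Rd N, psis, oms) ->
  {in `[0, 1] &, forall t t', `|ys t - ys t'| <= c * `|t - t'|} ->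
  (forall t : R, t \in `[0, 1] -> forall y, `|y - ys t| <= r ->
    `|G y - G (ys t)| <= C * `|y - ys t|) ->
  exists2 L : R, 0 <= L &
    {in `[-1, 1] &, forall x y, `|der vs x - der vs y| <= L * `|x - y|}.
Proof.
move=> vs ys tau0 tauoms r0 C0 c0 fp ylip Glip.
have oms0 := lt_le_trans tau0 tauoms.
have usE (t : R) : t \in `[0, 1] -> us t = oms *: G (ys t).
  by move=> t01; have /(congr1 (fun z => z.1.1 t)) /= := fp; rewrite t01.
have psisE : v1 vs = psis by have /(congr1 (fun z => z.1.2)) := fp.
(* The first summand serves times whose windows are within [r], where [G] is Lipschitz. The second
   serves times with [c * |x - y| > r]: there the trivial bound [2 * |us|] is at most
   [2 * |us| * (c / r) * |x - y|]. *)
pose L := oms * (C * c) + 2 * `|us| * (c / r).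
have L0 : 0 <= L.
  by apply: addr_ge0; apply: mulr_ge0; rewrite ?mulr_ge0 ?invr_ge0// ltW.
have usL : {in `[0, 1] &, forall x y, `|us x - us y| <= L * `|x - y|}.
  move=> x y x01 y01; rewrite /L mulrDl.
  have [near|far] := leP (c * `|x - y|) r.
    rewrite ler_wpDr//; first by rewrite !mulr_ge0// invr_ge0 ltW.
    rewrite !usE// -scalerBr normrZ gtr0_norm// -!mulrA.
    apply: ler_wpM2l; first exact: ltW.
    have xy := ylip _ _ x01 y01.
    by rewrite (le_trans (Glip _ y01 _ (le_trans xy near)))// ler_wpM2l.
  rewrite ler_wpDl//; first by rewrite !mulr_ge0// ltW.
  rewrite (le_trans (ler_normB _ _))// (@le_trans _ _ (2 * `|us|))//.
    by rewrite mulr_natl mulr2n lerD ?Binf_norm_ub.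
  rewrite -[leRHS]mulrA ler_peMr ?mulr_ge0// mulrAC ler_pdivlMr// mul1r.
  exact: ltW.
have us01 : us 1 = us 0.
  rewrite !usE ?in_itv/= ?lexx ?ler01//; congr (_ *: G _).
  apply: Binf_eqP => x xt; rewrite /= /window_fun xt.
  have /andP[s1 s0] := s_itv tau0 tauoms xt.
  have sN10 : s_ oms x \in `[-1, 0] by rewrite in_itv/= s1.
  have /(congr1 (fun w => fct w (s_ oms x))) := psisE.
  rewrite /= /translate_fun sN10 => ->.
  by rewrite add0r /glue_fct sN10.
have derpos (x : R) : x \in `[0, 1] -> der vs x = us x.
  by move=> x01; rewrite /= /glue_der x01.
have derneg (x : R) : -1 <= x -> x < 0 -> der vs x = us (1 + x).
  move=> x1 x0; have xN10 : x \in `[-1, 0] by rewrite in_itv/= x1 ltW.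
  have -> : der vs x = der psis x.
    by rewrite /= /glue_der xN10 in_itv/= leNgt x0.
  rewrite -psisE /= /translate_fun xN10 /glue_der.
  have -> // : 1 + x \in `[0, 1].
  by rewrite in_itv/=; apply/andP; split; lra.
have neg01 (x : R) : -1 <= x -> x < 0 -> 1 + x \in `[0, 1].
  by move=> x1 x0; rewrite in_itv/=; apply/andP; split; lra.
have i0 : 0 \in `[0, 1 : R] by rewrite in_itv/= lexx ler01.
have i1 : 1 \in `[0, 1 : R] by rewrite in_itv/= lexx ler01.
(* The comparison goes through the common value [us 1 = us 0]; as [x < 0 <= y], [|x - y|] is the
   distance from [1 + x] to 1 plus that from 0 to [y]. *)
have mixed (x y : R) : -1 <= x -> x < 0 -> y \in `[0, 1] ->
    `|der vs x - der vs y| <= L * `|x - y|.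
  move=> x1 x0 y01; have y0 : 0 <= y by move: y01; rewrite in_itv/= => /andP[].
  rewrite derneg// derpos// -(subrKA (us 1)) [X in _ + (X - _)]us01.
  rewrite (le_trans (ler_normD _ _))//.
  have -> : L * `|x - y| = L * `|1 + x - 1| + L * `|0 - y|.
    rewrite -mulrDr addrAC subrr !add0r normrN distrC (ltr0_norm x0).
    by rewrite !ger0_norm ?[_ + y]addrC// subr_ge0 (le_trans (ltW x0)).
  by apply: lerD; apply: usL => //; exact: neg01.
have case01 (x : R) : x \in `[-1, 1] -> -1 <= x /\ x < 0 \/ x \in `[0, 1].
  rewrite !in_itv/= => /andP[-> ->]; rewrite andbT.
  by case: (ltP x 0); [left|right].
exists L => // x y /case01[[x1 x0]|x01] /case01[[y1 y0]|y01].
- rewrite !derneg//; apply: (le_trans (usL _ _ _ _)); rewrite ?neg01//.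
  by rewrite opprD addrACA subrr add0r.
- exact: mixed.
- by rewrite distrC [`|x - y|]distrC; exact: mixed.
- by rewrite !derpos//; exact: usL.
Qed.

(** * The Lipschitz estimate for the derivative of [Phi] *)

(** Telescoping for a scaled operator applied to a vector: the scalar changes first, then the
    operator ([p] to [q]), then the argument ([q] to [q']). *)
Lemma scale_sub_le (R : realType) (Z : normedModType R) (p q q' : Z)
    (om om' c1 c2 c3 : R) : 0 <= om' ->
  `|p| <= c1 -> `|p - q| <= c2 -> `|q - q'| <= c3 ->
  `|om *: p - om' *: q'| <= `|om - om'| * c1 + om' * (c2 + c3).
Proof.
move=> om'0 pc1 pqc2 qq'c3.
have -> : om *: p - om' *: q' = (om - om') *: p + om' *: ((p - q) + (q - q')).
  by rewrite scalerBl subrKA scalerBr subrKA.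
rewrite (le_trans (ler_normD _ _))// !normrZ (ger0_norm om'0).
apply: lerD; apply: ler_wpM2l => //.
by rewrite (le_trans (ler_normD _ _))// lerD.
Qed.

(** It is used twice: with [z] the window of an increment, and with [z] the weighted window of
    [der v] inside [frakM]. *)
Lemma frakL_lipschitz (R : realType) (d : nat) (N : vnorm R d) (tau : R)
    (G : Binf N (- tau) 0 -> Rd N) t (v vs : B1inf N (-1) 1) (om oms B k a e : R)
    (z zs : Binf N (- tau) 0) :
  let y := window (fct v) tau t om in
  let ys := window (fct vs) tau t oms in
  0 <= oms -> 0 <= B -> 0 <= k ->
  (forall h, `|'d G y h| <= B * `|h|) ->
  (forall h, `|'d G ys h| <= B * `|h|) ->
  (forall h, `|'d G y h - 'd G ys h| <= k * `|h|) ->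
  `|z| <= a -> `|z - zs| <= e ->
  `|frakL G t v om z - frakL G t vs oms zs|
    <= `|om - oms| * (B * a) + oms * (k * a + B * e).
Proof.
move=> y ys oms0 B0 k0 HB HBs Hk za ze.
apply: (@scale_sub_le _ _ _ ('d G ys z)) => //.
- by rewrite (le_trans (HB _))// ler_wpM2l.
- by rewrite (le_trans (Hk _))// ler_wpM2l.
- by rewrite -linearB (le_trans (HBs _))// ler_wpM2l.
Qed.

Lemma UABnorm_le (R : realType) (d : nat) (N : vnorm R d)
    (z : (R -> Rd N) * B1inf N (-1) 0 * R^o) (c : R) :
  (forall t, t \in `[0, 1] -> `|z.1.1 t| <= c) -> `|z.1.2| <= c ->
  `|z.2| <= c -> (UABnorm z <= c%:E)%E.
Proof.
move=> z1 z2 z3; rewrite /UABnorm !ge_max !lee_fin z2 z3 !andbT.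
by apply: ge_ereal_sup => _ [t t01 <-]; rewrite lee_fin z1.
Qed.

Theorem proposition2p4 (R : realType) (d : nat) (N : vnorm R d) (tau : R)
    (G : Binf N (- tau) 0 -> Rd N) (p : {linear B1inf N 0 1 -> R^o})
    (us : Binf N 0 1) (psis : B1inf N (-1) 0) (oms : R) :
  (0 < d)%N -> 0 < tau ->
  (exists C : R, forall v : B1inf N (-1) 1, `|p (res01 v)| <= C * `|v|) ->
  (forall y : Binf N (- tau) 0, differentiable G y) ->
  0 < oms -> tau <= oms ->
  let xs : UAB R N := (us, psis, oms) in
  let vs := calG us psis in
  Phi G p xs = (us : R -> Rd N, psis, oms) ->
  (exists r kappa : R, [/\ 0 < r, 0 <= kappa &
    forall t : R, t \in `[0, 1] ->
    forall y : Binf N (- tau) 0,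
    let ys := window (fct vs) tau t oms in
    closed_ball ys r y ->
    (opnorm (fun z : Rd N => `|z|%:E) setT (fun h => 'd G y h - 'd G ys h)%R
       <= (kappa * `|y - ys|)%:E)%E]) ->
  exists r2 kappa2 : R, [/\ 0 < r2 < oms, 0 <= kappa2 &
    forall x : UAB R N, closed_ball xs r2 x -> tau <= x.2 ->
    (opnorm (@UABnorm R d N) [set h : UAB R N | 0 < h.2]%R
        (fun h => DPhi G p x h - DPhi G p xs h)%R
       <= (kappa2 * `|x - xs|)%:E)%E].
Proof.
move=> _ tau0 _ dG oms0 tauoms xs vs fp [r [kappa [r0 kappa0 dGball]]].
pose ys t := window (fct vs) tau t oms.
have dGlip (t : R) : t \in `[0, 1] -> forall y, `|y - ys t| <= r ->
    forall h, `|'d G y h - 'd G (ys t) h| <= kappa * `|y - ys t| * `|h|.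
  move=> t01 y yt; apply: (@opnorm_ub _ _ _ (fun h => 'd G y h - 'd G (ys t) h)).
    by rewrite (linear0 ('d G y)) (linear0 ('d G (ys t))) subr0.
  by apply: dGball => //; rewrite closed_ballE//= /closed_ball_/= distrC.
have [K1 K10 winL] := window_lipschitz N.
have [A A0 calGA] := calG_norm_le N.
have [K K0 mvt] := mean_value_le N.
have ysL : {in `[0, 1] &,
    forall t t', `|ys t - ys t'| <= K1 * `|der vs| * `|t - t'|}.
  move=> t t' t01 t'01; have := winL vs tau t t' oms oms tau0 tauoms tauoms t01 t'01.
  by rewrite subrr normr0 mul0r addr0.
have K1v0 : 0 <= K1 * `|der vs| by rewrite mulr_ge0// ltW.
have [B B0 dGB] := diff_bounded_near_curve r0 kappa0 K1v0 ysL dG dGlip.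
(* The segment from [ys t] to [y] stays in the ball of radius [r], where [B] bounds the
   differential. *)
have GL (t : R) : t \in `[0, 1] -> forall y, `|y - ys t| <= r ->
    `|G y - G (ys t)| <= K * B * `|y - ys t|.
  move=> t01 y yt; rewrite -mulrA; apply: mvt => //; first exact: mulr_ge0.
  move=> s /andP[s0 s1]; apply: dGB t01 _ _ _.
  rewrite addrAC subrr add0r normrZ ger0_norm//.
  by rewrite (le_trans _ yt)// ler_piMl.
have KB0 : 0 <= K * B by rewrite mulr_ge0// ltW.
have [L L0 derL] :=
  fixed_point_der_lipschitz tau0 tauoms r0 KB0 K1v0 fp ysL GL.
(* [c1] is the Lipschitz constant of the window at the fixed point: [A] for the change of function,
   the rest for the change of period. *)
pose c1 := A + K1 * `|der vs| / tau.
have c10 : 0 < c1 by rewrite ltr_wpDr// divr_ge0// ltW.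
(* The first bound gives [r2 < oms]; the second keeps the perturbed windows within [r] of the
   curve. *)
pose r2 := Num.min (oms / 2) (r / c1).
have r20 : 0 < r2 by rewrite lt_min !divr_gt0.
(* [a] bounds the weighted window of [der v], and [e] is its Lipschitz constant at the fixed point.
   [k1] then serves the [frakL] part of [DPhi] and [k2] the [frakM] part. *)
pose a := tau^-1 * (`|der vs| + A * r2).
pose e := tau^-1 * A + (2 * `|der vs| + L) / tau ^+ 2.
pose k1 := B * A + oms * (kappa * c1 * A + B * (K1 * A / tau)).
pose k2 := K * B * c1 + (B * a + oms * (kappa * c1 * a + B * e)).
have Ar20 : 0 <= A * r2 by rewrite mulr_ge0// ltW.
have a0 : 0 <= a by rewrite mulr_ge0 ?addr_ge0// invr_ge0 ltW.
have e0 : 0 <= e.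
  by rewrite addr_ge0// mulr_ge0 ?invr_ge0 ?sqr_ge0 ?addr_ge0 ?mulr_ge0// ltW.
have c1' := ltW c10; have oms' := ltW oms0; have A' := ltW A0; have K' := ltW K0.
have K1' := ltW K10; have tau' : 0 <= tau^-1 by rewrite invr_ge0 ltW.
have k10 : 0 <= k1.
  by rewrite !(addr_ge0, mulr_ge0).
have k20 : 0 <= k2.
  by rewrite !(addr_ge0, mulr_ge0, invr_ge0, sqr_ge0)// ltW.
exists r2, (k1 + k2); split.
- by rewrite r20/= gt_min ltr_pdivrMr// ltr_pMr// ltr1n.
- exact: addr_ge0.
move=> [[uh psih] om]; rewrite closed_ballE//= /closed_ball_/=.
set x : UAB R N := (uh, psih, om); rewrite distrC => xr2 tauom.
set dl := `|x - xs| in xr2 *.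
have dl0 : 0 <= dl by exact: normr_ge0.
have norm3 (w : UAB R N) : [/\ `|w.1.1| <= `|w|, `|w.1.2| <= `|w| & `|w.2| <= `|w|].
  by rewrite !prod_normE; split; rewrite !le_max lexx ?orbT.
have [dlu dlp dlom] : [/\ `|uh - us| <= dl, `|psih - psis| <= dl & `|om - oms| <= dl].
  exact: (norm3 (x - xs)).
pose v := calG uh psih.
have vvs : `|v - vs| <= A * dl by rewrite calGB calGA.
have [vvf vvd] : `|fct v - fct vs| <= A * dl /\ `|der v - der vs| <= A * dl.
  by split; apply: (le_trans _ vvs); rewrite B1inf_normE ?lerDl ?lerDr.
have yys t : t \in `[0, 1] -> `|window (fct v) tau t om - ys t| <= c1 * dl.
  move=> t01; rewrite -(subrKA (window (fct vs) tau t om)) -windowB.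
  rewrite (le_trans (ler_normD _ _))// mulrDl lerD//.
    by rewrite (le_trans (window_norm_le _ _ _ _)).
  rewrite (le_trans (winL _ _ _ _ _ _ tau0 tauom tauoms t01 t01))//.
  by rewrite subrr normr0 add0r mulrA mulrAC ler_wpM2l// ?mulr_ge0.
have c1r : c1 * dl <= r.
  by rewrite mulrC -ler_pdivlMr// (le_trans xr2)// ge_min lexx orbT.
apply: opnorm_le => -[[u psi] w] /= w0.
set h : UAB R N := (u, psi, w).
have [hu hp hw] := norm3 h; rewrite /= in hu hp hw.
have rhs0 : 0 <= (k1 + k2) * dl * `|h|.
  by apply: mulr_ge0 => //; apply: mulr_ge0 => //; exact: addr_ge0.
apply: UABnorm_le => /=; rewrite ?subrr ?normr0//.
move=> t t01; rewrite -[X in `|X| <= _]/((if t \in `[0, 1] then _ else _)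
  - (if t \in `[0, 1] then _ else _)) t01.
set dv := calG u psi; rewrite -/v -/vs opprD addrACA -scalerBr.
have dvA : `|dv| <= A * `|h| by exact: calGA.
have [dvf dvd] : `|fct dv| <= A * `|h| /\ `|der dv| <= A * `|h|.
  by split; apply: (le_trans _ dvA); rewrite B1inf_normE ?lerDl ?lerDr.
have yr := le_trans (yys t t01) c1r.
have ysr : `|ys t - ys t| <= r by rewrite subrr normr0 ltW.
have kc0 : 0 <= kappa * (c1 * dl) by rewrite !mulr_ge0.
have Hk h' : `|'d G (window (fct v) tau t om) h' - 'd G (ys t) h'|
    <= kappa * (c1 * dl) * `|h'|.
  rewrite (le_trans (dGlip t t01 _ yr h'))// ler_wpM2r// ler_wpM2l//.
  exact: yys.
have HL := @frakL_lipschitz _ _ _ _ G t v vs om oms B (kappa * (c1 * dl)) _ _ _ _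
  oms' B0 kc0 (dGB t t01 _ yr) (dGB t t01 _ ysr) Hk.
have H1 : `|frakL G t v om (window (fct dv) tau t om)
    - frakL G t vs oms (window (fct dv) tau t oms)| <= k1 * dl * `|h|.
  have za : `|window (fct dv) tau t om| <= A * `|h|.
    by rewrite (le_trans (window_norm_le _ _ _ _)).
  (* The increment [dv] is a primitive with [|der dv| <= A * |h|], so its window varies with the
     period at a rate proportional to [|h|]. *)
  have ze : `|window (fct dv) tau t om - window (fct dv) tau t oms|
      <= K1 * A / tau * dl * `|h|.
    rewrite (le_trans (winL _ _ _ _ _ _ tau0 tauom tauoms t01 t01))//.
    rewrite subrr normr0 add0r.
    rewrite (_ : K1 * A / tau * dl * _ = K1 * (A * `|h|) * (dl / tau)); last by ring.
    by rewrite ler_pM ?mulr_ge0// ?ler_wpM2l ?ler_wpM2r.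
  rewrite (le_trans (HL _ _ _ _ za ze))//.
  have -> : k1 * dl * `|h| = dl * (B * (A * `|h|)) + oms * (kappa * (c1 * dl) *
      (A * `|h|) + B * (K1 * A / tau * dl * `|h|)) by rewrite /k1; ring.
  by rewrite lerD2r ler_wpM2r// !mulr_ge0.
have H2 : `|frakL G t v om (wwindow (der v) tau t om)
    - frakL G t vs oms (wwindow (der vs) tau t oms)|
    <= (B * a + oms * (kappa * c1 * a + B * e)) * dl.
  have za : `|wwindow (der v) tau t om| <= a.
    rewrite (le_trans (wwindow_norm_le _ _ tau0 tauom))// ler_wpM2l//.
    rewrite -[der v](subrK (der vs)) addrC (le_trans (ler_normD _ _))// lerD//.
    by rewrite (le_trans vvd)// ler_wpM2l.
  have ze : `|wwindow (der v) tau t om - wwindow (der vs) tau t oms| <= e * dl.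
    (* The function changes first, at the period [om]; the period then changes for [der vs] only,
       since [derL] concerns the fixed point and [der v] may be merely measurable. *)
    rewrite -(subrKA (wwindow (der vs) tau t om)) -wwindowB mulrDl.
    rewrite (le_trans (ler_normD _ _))// lerD//.
      rewrite (le_trans (wwindow_norm_le _ _ tau0 tauom))// -mulrA.
      by rewrite ler_wpM2l.
    rewrite (le_trans (wwindow_lipschitz L0 derL tau0 tauom tauoms t01))//.
    by rewrite ler_wpM2l// mulr_ge0 ?invr_ge0 ?sqr_ge0// addr_ge0 ?mulr_ge0.
  rewrite (le_trans (HL _ _ _ _ za ze))//.
  have -> : (B * a + oms * (kappa * c1 * a + B * e)) * dl = dl * (B * a) +
      oms * (kappa * (c1 * dl) * a + B * (e * dl)) by ring.
  by rewrite lerD2r ler_wpM2r// mulr_ge0.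
have H3 : `|frakM G t v om - frakM G t vs oms| <= k2 * dl.
  rewrite /frakM opprD addrACA (le_trans (ler_normD _ _))// [k2 * _]mulrDl.
  apply: lerD.
    rewrite (le_trans (GL t t01 _ yr))// -[leRHS]mulrA ler_wpM2l//; exact: yys.
  by rewrite opprK addrC distrC.
rewrite (le_trans (ler_normD _ _))// [(k1 + k2) * dl]mulrDl [leRHS]mulrDl.
by apply: lerD => //; rewrite normrZ [leRHS]mulrC ler_pM.
Qed.
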